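(* Let $i\in\mathcal V$ and $j\in\mathbb Z_{\ge0}$. Assume that $\mathcal C_i(j)$ is not a singleton and that $F_i(j)\cap\operatorname{ri}(\mathcal C_i(j))\neq\emptyset$. Then the lexicographic selection (see context) at $(i,j)$ produces $z_i(j+1)=x_i(M)\in\operatorname{ri}(\mathcal C_i(j))$.
   Context: Setting. There are $\ell\in\mathbb N$ agents, $\mathcal V=\{1,\dots,\ell\}$, with dynamics $x_i(t+1)=g_i(x_i(t),u_i(t))$, $x_i(t)\in\mathcal X_i\subseteq\mathbb R^d$, $u_i(t)\in\mathcal U_i\subseteq\mathbb R^{m_i}$. Each $g_i$ is continuous, locally Lipschitz, and $\mathcal K$-bounded: there are $\kappa_{1,i},\kappa_{2,i}\in\mathcal K_\infty$ with $\|g_i(x,u)\|\le\kappa_{1,i}(\|x\|)+\kappa_{2,i}(\|u\|)$ for all $x\in\mathcal X_i,u\in\mathcal U_i$. (A function is of class $\mathcal K_\infty$ if it is continuous, strictly increasing, zero at zero and unbounded on $[0,\infty)$.) $\|\cdot\|$ is a norm on $\mathbb R^d$. Fix $M\in\mathbb N$ and set $z_i(j)=x_i(jM)$. At outer time $j$ the communication structure is a directed graph $(\mathcal V,\mathcal E(j))$, with $\mathcal N_i(j)=\{k:(k,i)\in\mathcal E(j)\}$. Local barycenter: $\bar z_i(j)=\frac{1}{1+|\mathcal N_i(j)|}\sum_{k\in\{i\}\cup\mathcal N_i(j)}z_k(j)$. Local hull: $\mathcal C_i(j)=\operatorname{co}(\{z_i(j)\}\cup\{z_k(j):k\in\mathcal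 N_i(j)\})$. $\operatorname{ri}$ denotes relative interior, $\partial\mathcal C_i(j)$ the relative boundary (boundary within the affine hull), and $\operatorname{dist}$ the Euclidean distance. OCP$_i(j)$: given positive definite $Q,R$ and $\alpha\in\mathcal K_\infty$ with $\alpha<\mathrm{id}$ (i.e. $\alpha(s)<s$ for $s>0$), minimize over $u_i(0),\dots,u_i(M-1)$ the primary cost $$J_i=\sum_{k=0}^{M-1}\big(\|x_i(k)-\bar z_i(j)\|_Q^2+\|u_i(k)-u_i(k-1)\|_R^2\big)$$ subject to $x_i(0)=z_i(j)$; $x_i(k+1)=g_i(x_i(k),u_i(k))$, $x_i(k)\in\mathcal X_i$, $u_i(k)\in\mathcal U_i$ for $k=0,\dots,M-1$; $x_i(M)\in\mathcal X_i\cap\mathcal C_i(j)$; and $\|x_i(M)-\bar z_i(j)\|\le\alpha(\|x_i(0)-\bar z_i(j)\|)$. Here $\|y\|_P^2=y^\top Py$, and $u_i(-1)$ is a given vector (the previously applied input). Standing assumption of the problem: for each $i$ there is an admissible finite-step feedback law $q_i=(q_i^1,\dots,q_i^M):\mathcal X_i\times\bar{\mathcal Z}_i\to\mathcal U_i^M$, where $\bar{\mathcal Z}_i$ is the set of all possible values of $\bar z_i$; admissible means that $g_i(x_i(jM+k-1),q_i^k(x_i(jM),\bar z_i(j)))\in\mathcal X_i$ for all $x_i(jM)\in\mathcal X_i$, $\bar z_i(j)\in\bar{\mathcal Z}_i$, $k=1,\dots,M$; and along the resulting trajectory $\|x_i((j+1)M)-\bar z_i(j)\|\le\alpha(\|x_i(jM)-\bar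 z_i(j)\|)$ (finite-step Lyapunov decay). Feasible terminal set: $F_i(j)$ is the set of $\xi\in\mathbb R^d$ for which there is an optimizer $u_i^\star(0{:}M-1)$ of OCP$_i(j)$ whose associated state trajectory satisfies $x_i^\star(M)=\xi$. By construction $F_i(j)\subseteq\mathcal C_i(j)$. Lexicographic selection at $(i,j)$: (1) solve OCP$_i(j)$ to obtain the optimal value $J_i^\star(j)$; (2) maximize the interiority measure $\phi_{i,j}(\xi)=\operatorname{dist}(\xi,\partial\mathcal C_i(j))$ over those $\xi\in F_i(j)$ that are terminal states $x_i(M)=\xi$ of a feasible solution with $J_i\le J_i^\star(j)$. Any maximizer $\xi^\dagger$ is selected, and the implemented update is $z_i(j+1)=x_i(M)=\xi^\dagger$. *)

(* Defs.v *)
From HB Require Import structures.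
From mathcomp Require Import all_boot all_order all_algebra.
From mathcomp Require Import all_classical all_reals all_analysis.

Set Implicit Arguments.
Unset Strict Implicit.
Unset Printing Implicit Defensive.

Import Order.TTheory GRing.Theory Num.Theory.
Import numFieldNormedType.Exports.

Local Open Scope classical_set_scope.
Local Open Scope ring_scope.

Definition class_Kinfty (R : realType) (f : R -> R) : Prop :=
  [/\ {within `[0, +oo[, continuous f},
      {in `[0, +oo[ &, {homo f : s t / s < t}},
      f 0 = 0 &
      forall B : R, exists2 s, 0 <= s & B < f s].

Definition is_norm (R : realType) (V : lmodType R) (N : V -> R) : Prop :=
  [/\ forall x y, N (x + y) <= N x + N y,
      forall (a : R) x, N (a *: x) = `|a| * N x &
      forall x, N x = 0 -> x = 0].

Definition K_bounded (R : realType) (V W : lmodType R) (NV : V -> R) (NW : W -> R)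
    (X : set V) (U : set W) (g : V -> W -> V) : Prop :=
  exists kappa1 kappa2 : R -> R,
    [/\ class_Kinfty kappa1, class_Kinfty kappa2 &
        forall x u, X x -> U u -> NV (g x u) <= kappa1 (NV x) + kappa2 (NW u)].

Definition posdef (R : realType) n (P : 'M[R]_n) : Prop :=
  P^T = P /\ forall v : 'cV[R]_n, v != 0 -> 0 < (v^T *m P *m v) 0 0.

Definition sqnorm (R : realType) n (P : 'M[R]_n) (v : 'cV[R]_n) : R :=
  (v^T *m P *m v) 0 0.

Definition enorm (R : realType) n (v : 'cV[R]_n) : R :=
  Num.sqrt (\sum_k v k 0 ^+ 2).

(* [inf set0 = 0], so this is the Euclidean distance only when [A !=set0]. *)
Definition edistance (R : realType) n (x : 'cV[R]_n) (A : set 'cV[R]_n) : R :=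
  inf [set enorm (x - a) | a in A].

Definition convex_hull (R : realType) (V : lmodType R) (A : set V) : set V :=
  smallest (@convex_set R V) A.

Definition affine_set (R : realType) (V : lmodType R) (A : set V) : Prop :=
  forall x y (t : R), A x -> A y -> A (t *: x + (1 - t) *: y).

Definition affine_hull (R : realType) (V : lmodType R) (A : set V) : set V :=
  smallest (@affine_set R V) A.

(* [subspace D] is the whole type [V] with the topology induced on [D] and every
   point outside [D] isolated.  Since [A] is contained in [affine_hull A], the
   interior and the closure of [A] in [subspace (affine_hull A)] are those taken
   within the affine hull. *)
Definition ri (R : realType) (V : normedModType R) (A : set V) : set V :=
  (A : set (subspace (affine_hull A)))°.

Definition rel_boundary (R : realType) (V : normedModType R) (A : set V) :
    set V :=
  closure (A : set (subspace (affine_hull A))) `\` ri A.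

Fixpoint traj (X U : Type) (g : X -> U -> X) (x0 : X) (u : nat -> U) (k : nat) :
    X :=
  if k is k'.+1 then g (traj g x0 u k') (u k') else x0.

(* Finite input sequences [u(0), ..., u(horizon - 1)] are represented by
   functions on [nat] of which only the first [horizon] values are used. *)
Record ocp (R : realType) (d m : nat) := Ocp {
  horizon : nat;
  state_norm : 'cV[R]_d -> R;
  states : set 'cV[R]_d;
  inputs : set 'cV[R]_m;
  dyn : 'cV[R]_d -> 'cV[R]_m -> 'cV[R]_d;
  state_weight : 'M[R]_d;
  input_weight : 'M[R]_m;
  decay : R -> R;
  init : 'cV[R]_d;
  last_input : 'cV[R]_m;
  center : 'cV[R]_d;
  target : set 'cV[R]_d
}.

Section OptimalControlProblem.
Context (R : realType) (d m : nat) (P : ocp R d m).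
Implicit Types (u v : nat -> 'cV[R]_m) (xi eta : 'cV[R]_d).

Definition state u : nat -> 'cV[R]_d := traj (dyn P) (init P) u.

Definition previous u (k : nat) : 'cV[R]_m :=
  if k is k'.+1 then u k' else last_input P.

Definition cost u : R :=
  \sum_(0 <= k < horizon P)
    (sqnorm (state_weight P) (state u k - center P) +
     sqnorm (input_weight P) (u k - previous u k)).

Definition feasible u : Prop :=
  [/\ forall k, (k < horizon P)%N -> states P (state u k) /\ inputs P (u k),
      states P (state u (horizon P)),
      target P (state u (horizon P)) &
      state_norm P (state u (horizon P) - center P) <=
        decay P (state_norm P (init P - center P))].

Definition optimizer u : Prop :=
  feasible u /\ forall v, feasible v -> cost u <= cost v.

Definition optimal_value : R := inf [set cost u | u in feasible].

Definition feasible_terminal_set : set 'cV[R]_d :=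
  [set state u (horizon P) | u in optimizer].

Definition interiority xi : R := edistance xi (rel_boundary (target P)).

Definition lex_candidates : set 'cV[R]_d :=
  [set xi | feasible_terminal_set xi /\
    exists u, [/\ feasible u, state u (horizon P) = xi &
                  cost u <= optimal_value]].

Definition lex_selected : set 'cV[R]_d :=
  [set xi | lex_candidates xi /\
    forall eta, lex_candidates eta -> interiority eta <= interiority xi].

End OptimalControlProblem.

Section Communication.
Context (R : realType) (d l : nat).

(* [e k i] is the directed edge [(k, i)]: agent [i] receives from agent [k]. *)
Implicit Types (e : rel 'I_l) (i : 'I_l) (z : 'I_l -> 'cV[R]_d).

Definition neighbours e i : pred 'I_l := [pred k | e k i].

Definition barycenter e i z : 'cV[R]_d :=
  ((1 + #|neighbours e i|)%:R : R)^-1 *: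
    \sum_(k | (k == i) || neighbours e i k) z k.

Definition local_hull e i z : set 'cV[R]_d :=
  convex_hull [set z k | k in [set k | (k == i) || neighbours e i k]].

(* The values the barycenter of agent [i] can take: the graphs [E j] are data,
   the states are free in the state constraint sets. *)
Definition barycenter_values (E : nat -> rel 'I_l)
    (X : 'I_l -> set 'cV[R]_d) i : set 'cV[R]_d :=
  [set zbar | exists j z, (forall k, X k (z k)) /\ zbar = barycenter (E j) i z].

End Communication.

Definition admissible_decay_law (R : realType) (d m M : nat)
    (N : 'cV[R]_d -> R) (X Zbar : set 'cV[R]_d) (U : set 'cV[R]_m)
    (g : 'cV[R]_d -> 'cV[R]_m -> 'cV[R]_d) (alpha : R -> R)
    (q : nat -> 'cV[R]_d -> 'cV[R]_d -> 'cV[R]_m) : Prop :=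
  forall xi zbar, X xi -> Zbar zbar ->
    let x := traj g xi (fun k => q k xi zbar) in
    [/\ forall k, (k < M)%N -> U (q k xi zbar),
        forall k, (k < M)%N -> X (x k.+1) &
        N (x M - zbar) <= alpha (N (xi - zbar))].

(* Main.v *)
(* An optimizer ending in the relative interior of the local hull makes the maximal
   interiority positive, because the relative boundary is relatively closed, whereas
   a terminal state in the hull but outside its relative interior lies on the
   relative boundary and has interiority zero.  The argument needs a nonempty
   relative boundary, which holds since the hull is bounded and not a singleton. *)
Require Import Defs.
From HB Require Import structures.
From mathcomp Require Import all_boot all_order all_algebra.
From mathcomp Require Import all_classical all_reals all_analysis.

Set Implicit Arguments.
Unset Strict Implicit.
Unset Printing Implicit Defensive.

Import Order.TTheory GRing.Theory Num.Theory.
Import numFieldNormedType.Exports.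

Local Open Scope classical_set_scope.
Local Open Scope ring_scope.

Section RelativeTopology.
Context (R : realType) (V : normedModType R).
Implicit Types (A B D : set V) (x p q : V).

(** Points outside [D] are isolated in [subspace D], so this metric form of relative neighbourhoods
    is stated at points of [D] only. *)
Lemma nbhs_subspace_normP D B x : D x ->
  nbhs (x : subspace D) B <->
  exists2 e : R, 0 < e & forall y, D y -> `|x - y| < e -> B y.
Proof.
move=> Dx; change (nbhs_subspace (x : subspace D) B <->
  exists2 e : R, 0 < e & forall y, D y -> `|x - y| < e -> B y).
rewrite -(nbhs_subspace_in Dx) /within /=; split.
  move=> /nbhs_ballP [e /= e0 eB]; exists e => // y Dy xy.
  by apply: eB => //; rewrite -ball_normE.
move=> [e e0 eB]; apply/nbhs_ballP; exists e => // y.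
by rewrite -ball_normE /= => xy Dy; exact: eB.
Qed.

Lemma bounded_set_normP A :
  bounded_set A <-> exists M : R, forall x, A x -> `|x| <= M.
Proof.
split=> [[M [_ AM]]|[M AM]].
  by exists (M + 1) => x Ax; apply: (AM (M + 1)) => //; rewrite ltrDl.
exists M; split=> [|N MN x Ax]; first exact: num_real.
by apply: le_trans (ltW MN); exact: AM.
Qed.

Lemma sub_affine_hull A : A `<=` affine_hull A.
Proof. exact: sub_gen_smallest. Qed.

Lemma affine_hull_affine A : affine_set (affine_hull A).
Proof. by move=> x y t Ax Ay B BA; apply: BA.1; [exact: Ax | exact: Ay]. Qed.

Lemma ri_sub A : ri A `<=` A.
Proof. exact: (@interior_subset (subspace (affine_hull A))). Qed.

Lemma not_ri_rel_boundary A x : A x -> ~ ri A x -> rel_boundary A x.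
Proof.
by move=> Ax Nx; split => //; exact: (@subset_closure (subspace (affine_hull A))).
Qed.

(** A point outside the affine hull is isolated, so its singleton is a neighbourhood that misses
    [A]. *)
Lemma rel_boundary_sub_affine_hull A : rel_boundary A `<=` affine_hull A.
Proof.
move=> x [clx _]; apply: contrapT => Nx.
have : nbhs (x : subspace (affine_hull A)) [set x].
  change (nbhs_subspace (x : subspace (affine_hull A)) [set x]).
  by rewrite -(nbhs_subspace_out Nx).
by move=> /clx [y [Ay yx]]; apply: Nx; rewrite -yx; exact: sub_affine_hull.
Qed.

(** A relative ball around [x] inside [A] consists of relatively interior points, so it meets no
    relative boundary point. *)
Lemma ri_rel_boundary_dist A x : ri A x ->
  exists2 e : R, 0 < e & forall y, rel_boundary A y -> e <= `|x - y|.
Proof.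
move=> rix; have Hx := sub_affine_hull (ri_sub rix).
have [e e0 eA] := (nbhs_subspace_normP _ Hx).1 rix.
exists e => // y By; rewrite leNgt; apply/negP => xy.
have Hy := rel_boundary_sub_affine_hull By; case: By => _; apply.
apply/(nbhs_subspace_normP _ Hy); exists (e - `|x - y|); first by rewrite subr_gt0.
move=> w Hw; rewrite ltrBrDl => yw; apply: eA => //.
by apply: le_lt_trans yw; exact: ler_distD.
Qed.

(* The line through [p] and [q] leaves the bounded set [A]; its last point in the
   closure of [A] lies on the relative boundary. *)
Lemma rel_boundary_nonempty A p q : bounded_set A -> A p -> A q -> p != q ->
  rel_boundary A !=set0.
Proof.
move=> bA Ap Aq pq.
have n0 : 0 < `|q - p| by rewrite normr_gt0 subr_eq0 eq_sym.
pose line (t : R) := t *: q + (1 - t) *: p.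
have lineH t : affine_hull A (line t).
  by apply: affine_hull_affine; exact: sub_affine_hull.
have lineB s t : line s - line t = (s - t) *: (q - p).
  rewrite /line opprD addrACA -!scalerBl scalerBr -scaleNr; congr (_ + _ *: _).
  by rewrite opprB addrC subrKA opprB.
pose T := [set t | A (line t)].
have supT : has_sup T.
  split; first by exists 1; rewrite /T /= /line scale1r subrr scale0r addr0.
  have [M AM] := (bounded_set_normP A).1 bA.
  (* The parameters [1] and [t] give points of [A] at distance |t - 1| |q - p|, which is at most
     [M + M]. *)
  exists (1 + (M + M) / `|q - p|) => t Tt.
  rewrite -lerBlDl ler_pdivlMr//; apply: (le_trans (ler_norm _)).
  rewrite normrM normr_id -normrZ -lineB (_ : line 1 = q).
    by apply: (le_trans (ler_normB _ _)); apply: lerD; exact: AM.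
  by rewrite /line subrr scale0r addr0 scale1r.
pose s := sup T.
exists (line s); split.
  move=> B /(nbhs_subspace_normP _ (lineH s)) [e e0 eB].
  (* A parameter of [T] within e / |q - p| of its supremum gives a point of [A] within [e] of
     [line s]. *)
  have [t Tt st] := sup_adherent (divr_gt0 e0 n0) supT.
  exists (line t); split => //; apply: eB => //.
  rewrite lineB normrZ ger0_norm ?subr_ge0; last exact: sup_upper_bound.
  by rewrite -ltr_pdivlMr// ltrBlDr addrC -ltrBlDr.
move=> /(nbhs_subspace_normP _ (lineH s)) [e e0 eA].
(* Half of e / |q - p| beyond [s], the line would still be in [A], against [s] being an upper bound
   of [T]. *)
have d0 : 0 < e / `|q - p| / 2 by rewrite !divr_gt0.
have : T (s + e / `|q - p| / 2).
  apply: eA => //; rewrite lineB normrZ opprD addNKr normrN gtr0_norm//.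
  by rewrite -ltr_pdivlMr// ltr_pdivrMr// ltr_pMr ?divr_gt0// ltr1n.
by move=> /(sup_upper_bound supT); rewrite gerDl leNgt d0.
Qed.

(** A closed ball around the origin that contains [A] is convex, so it contains the hull. *)
Lemma bounded_convex_hull A : bounded_set A -> bounded_set (convex_hull A).
Proof.
move=> bA; have [M AM] := (bounded_set_normP A).1 bA.
have ballM : convex_set ([set x | `|x| <= M] : set (convex_lmodType V)).
  apply/convex_setW => x y /set_mem xM /set_mem yM k k0 k1; apply/mem_set => /=.
  apply: (le_trans (ler_normD _ _)); rewrite !normrZ.
  rewrite !gtr0_norm ?subr_gt0//.
  apply: (@le_trans _ _ (k%:num * M + (1 - k%:num) * M)).
    by rewrite lerD// ler_wpM2l// ?ltW// subr_gt0.
  by rewrite -mulrDl addrC subrK mul1r.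
apply/bounded_set_normP; exists M => x; exact: (smallest_sub ballM AM).
Qed.

End RelativeTopology.

(** The norm of the topology is the maximum norm; this carries its lower bounds over to Euclidean
    distances. *)
Lemma norm_le_enorm (R : realType) n (v : 'cV[R]_n) : `|v| <= enorm v.
Proof.
rewrite /Num.norm /= mx_normrE; apply/bigmax_leP; split; first exact: sqrtr_ge0.
move=> [k l] _ /=; rewrite (ord1 l) -sqrtr_sqr ler_wsqrtr//.
by rewrite (bigD1 k)//= lerDl sumr_ge0// => h _; exact: sqr_ge0.
Qed.

Section Interiority.
Context (R : realType) (d m : nat) (P : ocp R d m).

(** The cost of an optimizer is a lower bound of all feasible costs, hence at most their infimum. *)
Lemma optimizer_lex_candidate u :
  optimizer P u -> lex_candidates P (state P u (horizon P)).
Proof.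
move=> [fu optu]; split; first by exists u.
exists u; split => //; apply: lb_le_inf; first by exists (cost P u), u.
by move=> _ [v fv <-]; exact: optu.
Qed.

(** The uniform gap to the relative boundary passes to the infimum; a nonempty boundary excludes the
    default value [inf set0 = 0]. *)
Lemma interiority_gt0 xi : rel_boundary (target P) !=set0 ->
  ri (target P) xi -> 0 < interiority P xi.
Proof.
move=> [b Bb] /ri_rel_boundary_dist [e e0 eB]; apply: (lt_le_trans e0).
apply: lb_le_inf; first by exists (enorm (xi - b)), b.
by move=> _ [y By <-]; apply: le_trans (norm_le_enorm _); exact: eB.
Qed.

Lemma interiority_rel_boundary xi : rel_boundary (target P) xi ->
  interiority P xi <= 0.
Proof.
move=> Bxi; apply: ge_inf.
  by exists 0 => _ [y _ <-]; exact: sqrtr_ge0.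
by exists xi => //; rewrite subrr /enorm big1 ?sqrtr0// => k _; rewrite mxE expr0n.
Qed.

Lemma lex_selected_ri xi : rel_boundary (target P) !=set0 ->
  feasible_terminal_set P `&` ri (target P) !=set0 ->
  lex_selected P xi -> ri (target P) xi.
Proof.
move=> ne [_ [[u optu <-] riu]] [[[v [[_ _ Cv _] _] <-] _] ximax].
apply: contrapT => Nri.
have := ximax _ (optimizer_lex_candidate optu).
apply/negP; rewrite -ltNge; apply: le_lt_trans (interiority_gt0 ne riu).
by apply: interiority_rel_boundary; exact: not_ri_rel_boundary.
Qed.

End Interiority.

Theorem lemma3 (R : realType) (l d M : nat) (m : 'I_l -> nat)
    (* constraint sets, dynamics, norms *)
    (X : 'I_l -> set 'cV[R]_d) (U : forall i, set 'cV[R]_(m i))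
    (g : forall i, 'cV[R]_d -> 'cV[R]_(m i) -> 'cV[R]_d)
    (N : 'cV[R]_d -> R) (Nu : forall i, 'cV[R]_(m i) -> R)
    (* OCP data *)
    (Q : 'I_l -> 'M[R]_d) (Rw : forall i, 'M[R]_(m i)) (alpha : 'I_l -> R -> R)
    (* communication graphs, state and input trajectories, values of u_i(-1) *)
    (E : nat -> rel 'I_l)
    (x : 'I_l -> nat -> 'cV[R]_d) (u : forall i, nat -> 'cV[R]_(m i))
    (uprev : forall i, nat -> 'cV[R]_(m i))
    (i : 'I_l) (j : nat) :
  let z (j' : nat) (k : 'I_l) := x k (j' * M)%N in
  let C := local_hull (E j) i (z j) in
  let P := Ocp M N (X i) (U i) (@g i) (Q i) (Rw i) (alpha i)
             (z j i) (uprev i j) (barycenter (E j) i (z j)) C in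
  (0 < M)%N ->
  is_norm N ->
  (forall k, is_norm (@Nu k)) ->
  (forall k, {within X k `*` U k,
    continuous (fun p : 'cV[R]_d * 'cV[R]_(m k) => g k p.1 p.2)}) ->
  (forall k, [locally [lipschitz
    (fun p : 'cV[R]_d * 'cV[R]_(m k) => g k p.1 p.2) p | p in X k `*` U k]]) ->
  (forall k, K_bounded N (@Nu k) (X k) (U k) (@g k)) ->
  (forall k, posdef (Q k) /\ posdef (@Rw k)) ->
  (forall k, class_Kinfty (alpha k)) ->
  (forall k s, 0 < s -> alpha k s < s) ->
  (forall k, exists q, admissible_decay_law M N (X k)
                         (barycenter_values E X k) (U k) (@g k) (alpha k) q) ->
  (forall k t, X k (x k t)) ->
  (forall k t, U k (u k t)) ->
  (forall k t, x k t.+1 = g k (x k t) (u k t)) ->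
  ~ (exists c, C = [set c]) ->
  feasible_terminal_set P `&` ri C !=set0 ->
  lex_selected P (z j.+1 i) ->
  ri C (z j.+1 i).
Proof.
move=> z C P _ _ _ _ _ _ _ _ _ _ _ _ _ Csing ne; apply: lex_selected_ri => //=.
have [xi [_ /ri_sub Cxi]] := ne.
(* Were there no second point, [C] would be the singleton of [xi]. *)
have [y Cy xiy] : exists2 y, C y & xi != y.
  apply: contrapT => Nex; apply: Csing; exists xi.
  apply/seteqP; split => [y Cy|_ -> //]; apply: contrapT => yxi.
  by apply: Nex; exists y => //; apply/eqP => /esym.
apply: (rel_boundary_nonempty _ Cxi Cy xiy); apply: bounded_convex_hull.
(* The hull is generated by the states of finitely many agents. *)
apply: compact_bounded; apply: finite_compact; apply: finite_image.
exact: finite_finset.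
Qed.
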